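(* Let $\mathcal G=(V,E,s,r)$ be a branching graph with a weight function $w:E\to(0,\infty)$. If a probability measure $P$ on the path space $\Omega$ is $\mathfrak S(\Omega)$-ergodic and $w$-central, then there exists a path $\omega\in\Omega$ such that $$\frac{P(X_K=v)}{w\text{-}\dim(v)}=\lim_{N\to\infty,\,K\le N}\frac{w\text{-}\dim(v,X_N(\omega))}{w\text{-}\dim(X_N(\omega))}$$ for every $K\ge1$ and every $v\in V_K$. In particular, if the weighted branching graph $(\mathcal G,w)$ is associated with an inductive system of compact quantum groups, then this holds true for every extremal $w$-central probability measure $P$.
   Context: **Branching graphs.** A branching graph $\mathcal G=(V,E,s,r)$ is a directed graph with source and range maps $s,r:E\to V$, $V=\bigsqcup_{N\ge0}V_N$, $E=\bigsqcup_{N\ge1}E_N$, such that $V_0=\{*\}$, each $V_N$ is countable, $|r^{-1}(\{v\})|<\infty$ for all $v$, and $s(E_N)=V_{N-1}$, $r(E_N)=V_N$ for all $N\ge1$. A path is a sequence of consecutive edges ($r(t_n)=s(t_{n+1})$); $\Omega(u,v)$ is the set of finite paths from $u$ to $v$; $w(t)$ is the product of the weights of the edges of $t$; $w\text{-}\dim(u,v)=\sum_{t\in\Omega(u,v)}w(t)$ and $w\text{-}\dim(v)=w\text{-}\dim( *,v)$. $\Omega$ is the space of infinite paths $\omega=(\omega_n)_{n\ge1}$ starting at $*$ with the $\sigma$-algebra generated by cylinder sets $C_t=\{\omega:\omega_n=t_n,\ n\le N\}$; $X_N(\omega)=r(\omega_N)$. A probability measure $P$ on $\Omega$ is $w$-central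 if $P(C_t)/w(t)=P(X_N=v)/w\text{-}\dim(v)$ for all $N\ge1$, $v\in V_N$, $t\in\Omega( *,v)$; the $w$-central measures form a convex set, and extremal means extreme point of it. For $v\in V_N$ each permutation $\gamma$ of $\Omega( *,v)$ acts on $\Omega$ by replacing $(\omega_1,\dots,\omega_N)$ by $\gamma(\omega_1,\dots,\omega_N)$ if $r(\omega_N)=v$ and fixing $\omega$ otherwise; $\mathfrak S_N(\Omega)$ is generated by these over $v\in V_N$, and $\mathfrak S(\Omega)=\bigcup_N\mathfrak S_N(\Omega)$. $P$ is $\mathfrak S(\Omega)$-ergodic if every $\mathfrak S(\Omega)$-invariant measurable set has $P$-measure $0$ or $1$. **Weighted branching graph of an inductive system.** A compact quantum group (CQG) $G=(A,\delta)$ is a unital $C^*$-algebra $A$ with a unital $*$-homomorphism $\delta:A\to A\otimes A$ (minimal tensor product), $(\mathrm{id}\otimes\delta)\delta=(\delta\otimes\mathrm{id})\delta$, $\delta(A)(A\otimes1)$ and $\delta(A)(1\otimes A)$ dense in $A\otimes A$; $A$ is assumed to be the universal $C^*$-algebra of the $*$-algebra spanned by matrix coefficients of finite-dimensional representations. A finite-dimensional representation on $V$ is an invertible $U\in B(V)\otimes A$ with $(\mathrm{id}\otimes\delta)(U)=U_{12}U_{13}$; unitary if $V$ is a Hilbert space and $U$ is unitary; $\mathrm{Mor}(U,V)=\{T:(T\otimes1)U=V(T\otimes1)\}$, $\mathrm{End}(U)=\mathrm{Mor}(U,U)$, irreducible means $\mathrm{End}(U)=\mathbb C1$; $\widehat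 G$ is the set of classes of irreducible unitary representations, with representatives $U_\pi$. $U^c=(j\otimes\mathrm{id})(U^{-1})$ with $j$ the transpose map, and $F_U\in\mathrm{Mor}(U,U^{cc})$ is the unique positive invertible element with $\mathrm{Tr}(F_U\,\cdot)=\mathrm{Tr}(F_U^{-1}\,\cdot)$ on $\mathrm{End}(U)$; $F_\pi=F_{U_\pi}$. An inductive system $\mathbb G=(G_N,\theta_N)_{N\ge0}$ consists of CQGs $G_N=(A_N,\delta_N)$, $G_0=(\mathbb C,\mathrm{id})$, each $\widehat G_N$ countable, and surjective $*$-homomorphisms $\theta_N:A_{N+1}\to A_N$ with $\delta_N\theta_N=(\theta_N\otimes\theta_N)\delta_{N+1}$. Its graph has $V_N=\widehat G_N$ and $E_N=\{[\rho,l,\pi]:\rho\prec\pi,\ 1\le l\le m_\pi(\rho)\}$, with source $\rho\in\widehat G_{N-1}$ and range $\pi\in\widehat G_N$, where $m_\pi(\rho)$ is the multiplicity of $\rho$ in the restriction $U_{\pi|}=(\mathrm{id}\otimes\theta_{N-1})(U_\pi)$ and $\rho\prec\pi$ means $m_\pi(\rho)\ge1$. There is a unique positive invertible $W_\pi\in\mathrm{End}(U_{\pi|})$ with $F_\pi=W_\pi F_{U_{\pi|}}=F_{U_{\pi|}}W_\pi$, and intertwiners $S_{\rho,l,\pi}\in\mathrm{Mor}(U_\rho,U_{\pi|})$ are chosen with $S_{\rho,l,\pi}^*S_{\rho',l',\pi}=\delta_{\rho,\rho'}\delta_{l,l'}1$, $\sum_{\rho,l}S_{\rho,l,\pi}S_{\rho,l,\pi}^*=1$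 and $W_\pi=\sum_{\rho,l}w(\rho,l,\pi)S_{\rho,l,\pi}S_{\rho,l,\pi}^*$, $w(\rho,l,\pi)$ nondecreasing in $l$. The weight function is $w([\rho,l,\pi])=w(\rho,l,\pi)$. *)

(* Defs.v *)
From HB Require Import structures.
From mathcomp Require Import all_boot all_order all_algebra.
From mathcomp Require Import all_classical all_reals all_analysis.
From mathcomp Require Export complex.

Set Implicit Arguments.
Unset Strict Implicit.
Unset Printing Implicit Defensive.

Import Order.TTheory GRing.Theory Num.Theory.
Import numFieldNormedType.Exports.

Local Open Scope classical_set_scope.
Local Open Scope ring_scope.
Local Open Scope complex_scope.
Local Open Scope sesquilinear_scope.

(* The decompositions V = |_| V_N (N >= 0) and E = |_| E_N (N >= 1) are given
   by the level functions [vlevel] and [elevel]. *)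
Record branching_graph := BranchingGraph {
  vertex : choiceType;
  edge : choiceType;
  src : edge -> vertex;
  rng : edge -> vertex;
  vlevel : vertex -> nat;
  elevel : edge -> nat;
  root : vertex;
  elevel_gt0 : forall e, (0 < elevel e)%N;
  vlevel0 : [set v | vlevel v = 0%N] = [set root];
  countable_vlevel : forall N, countable [set v | vlevel v = N];
  finite_rng : forall v, finite_set (rng @^-1` [set v]);
  src_level : forall N,
    src @` [set e | elevel e = N.+1] = [set v | vlevel v = N];
  rng_level : forall N,
    rng @` [set e | elevel e = N.+1] = [set v | vlevel v = N.+1] }.

Section paths.
Variable G : branching_graph.

Definition V_ (N : nat) : set (vertex G) := [set v | vlevel v = N].

Definition E_ (N : nat) : set (edge G) := [set e | elevel e = N].

Fixpoint is_path (u : vertex G) (t : seq (edge G)) (v : vertex G) : Prop :=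
  if t is e :: t' then src e = u /\ is_path (rng e) t' v else u = v.

(* The finite paths from u to v; the empty path is in paths u u. *)
Definition paths (u v : vertex G) : set (seq (edge G)) :=
  [set t | is_path u t v].

(* Paths are indexed from 0 here: [pedge w n] is the edge w_(n+1). *)
Record path_space := PathSpace {
  pedge :> nat -> edge G;
  pedge_root : src (pedge 0%N) = root G;
  pedge_consecutive : forall n, rng (pedge n) = src (pedge n.+1) }.

Lemma path_space_inhabited : exists _ : path_space, True.
Proof.
have /choice[f fP] (v : vertex G) : exists e, src e = v.
  have : [set v' | vlevel v' = vlevel v] v by [].
  by rewrite -src_level => -[e _ <-]; exists e.
pose x n := iter n (fun v => rng (f v)) (root G).
by exists (@PathSpace (fun n => f (x n)) (fP _) (fun n => esym (fP (x n.+1)))).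
Qed.

HB.instance Definition _ := gen_eqMixin path_space.
HB.instance Definition _ := gen_choiceMixin path_space.
HB.instance Definition _ :=
  isPointed.Build path_space (projT1 (cid path_space_inhabited)).

Definition cylinder (t : seq (edge G)) : set path_space :=
  [set om | mkseq om (size t) = t].

Definition cylinders : set (set path_space) :=
  [set B | exists2 t, (exists v, paths (root G) v t) & B = cylinder t].

Definition Omega := g_sigma_algebraType cylinders.

(* X N om is the vertex at level N of om. *)
Definition X (N : nat) (om : path_space) : vertex G :=
  if N is N'.+1 then rng (om N') else root G.

(* g is the transformation of the path space given by the permutation gamma
   of the paths from the root to v, where v has level N. *)
Definition acts_by (N : nat) (v : vertex G)
    (gamma : seq (edge G) -> seq (edge G)) (g : path_space -> path_space) :=
  forall om : path_space,
    (X N om = v -> mkseq (g om) N = gamma (mkseq om N) /\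
                   forall n, (N <= n)%N -> g om n = om n) /\
    (X N om <> v -> g om = om).

Definition elementary (N : nat) : set (path_space -> path_space) :=
  [set g | exists2 v, V_ N v &
    exists2 gamma, set_bij (paths (root G) v) (paths (root G) v) gamma &
      acts_by N v gamma g].

Inductive generated (T : Type) (S : set (T -> T)) : (T -> T) -> Prop :=
| generated_id : generated S id
| generated_gen g : S g -> generated S g
| generated_comp g h : generated S g -> generated S h -> generated S (g \o h)
| generated_inv g h : generated S g -> cancel g h -> cancel h g ->
    generated S h.

Definition perm_group (N : nat) : set (path_space -> path_space) :=
  generated (elementary N).

Definition perm_group_inf : set (path_space -> path_space) :=
  \bigcup_N perm_group N.

End paths.

Section central.
Variables (R : realType) (G : branching_graph) (w : edge G -> R).

Definition wpath (t : seq (edge G)) : R := \prod_(e <- t) w e.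

(* paths u v is finite, so this is a genuine sum. *)
Definition wdim (u v : vertex G) : R := \sum_(t \in paths u v) wpath t.

Definition wdim0 (v : vertex G) : R := wdim (root G) v.

Definition central (P : probability (Omega G) R) : Prop :=
  forall N v t, (1 <= N)%N -> V_ N v -> paths (root G) v t ->
    fine (P (cylinder t)) / wpath t =
    fine (P [set om | X N om = v]) / wdim0 v.

(* Equality of measures is equality on the measurable sets. *)
Definition extremal_central (P : probability (Omega G) R) : Prop :=
  central P /\
  forall (P1 P2 : probability (Omega G) R) (l : R),
    central P1 -> central P2 -> 0 < l < 1 ->
    (forall B, measurable B -> P B = (l%:E * P1 B + (1 - l)%:E * P2 B)%E) ->
    forall B, measurable B -> P1 B = P B /\ P2 B = P B.

Definition ergodic (P : probability (Omega G) R) : Prop :=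
  forall B : set (Omega G), measurable B ->
    (forall g, perm_group_inf g -> g @` B = B) ->
    P B = 0%E \/ P B = 1%E.

Definition approximated (P : probability (Omega G) R) : Prop :=
  exists om : path_space G, forall K v, (1 <= K)%N -> V_ K v ->
    (fun N : nat => wdim v (X N om) / wdim0 (X N om)) @ \oo -->
      fine (P [set om' | X K om' = v]) / wdim0 v.

End central.

(* Unital C*-algebras, nonzero as every algType.  (Hierarchy-Builder cannot
   join the structures of normed modules and of algebras after the fact, so
   the norm and the completeness are fields.) *)
Record cstar_algebra (R : realType) := CStarAlgebra {
  cstar_sort :> algType R[i];
  cnorm : cstar_sort -> R;
  cstar : cstar_sort -> cstar_sort;
  cnorm_eq0 : forall x, cnorm x = 0 -> x = 0;
  cnormD : forall x y, cnorm (x + y) <= cnorm x + cnorm y;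
  cnormZ : forall (c : R[i]) x, (cnorm (c *: x))%:C = `|c| * (cnorm x)%:C;
  cnorm_complete : forall x : nat -> cstar_sort,
    (forall e : R, 0 < e -> exists N : nat, forall m n,
       (N <= m)%N -> (N <= n)%N -> cnorm (x m - x n) < e) ->
    exists l, (fun n => cnorm (x n - l)) @ \oo --> (0 : R);
  cnormM : forall x y, cnorm (x * y) <= cnorm x * cnorm y;
  cstarK : involutive cstar;
  cstar_antilinear : forall (c : R[i]) x y,
    cstar (c *: x + y) = Num.conj c *: cstar x + cstar y;
  cstarM : forall x y, cstar (x * y) = cstar y * cstar x;
  cnorm_cstar : forall x, cnorm (cstar x * x) = cnorm x ^+ 2 }.

Section cstar.
Variable R : realType.
Local Notation C := R[i].

Definition lin_span (A : lmodType C) (D : set A) : set A :=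
  [set x | exists n (c : 'I_n -> C) (a : 'I_n -> A),
     (forall i, D (a i)) /\ x = \sum_(i < n) c i *: a i].

Definition norm_dense (A : cstar_algebra R) (D : set A) : Prop :=
  forall (x : A) (e : R), 0 < e -> exists2 y, D y & cnorm (x - y) < e.

(* f restricts to a unital *-homomorphism on the *-subalgebra D. *)
Definition star_hom_on (A B : cstar_algebra R) (D : set A) (f : A -> B) :=
  [/\ f 1 = 1,
      forall (c : C) x y, D x -> D y -> f (c *: x + y) = c *: f x + f y,
      forall x y, D x -> D y -> f (x * y) = f x * f y &
      forall x, D x -> f (cstar x) = cstar (f x)].

Definition star_hom (A B : cstar_algebra R) (f : A -> B) :=
  star_hom_on setT f.

Record hilbert_space := HilbertSpace {
  hilbert_sort :> completeNormedModType C;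
  hdot : {dot hilbert_sort for Num.Def.conjC};
  hdot_norm : forall x : hilbert_sort, hdot x x = `|x| ^+ 2 }.

(* pi is a unital *-representation of A by bounded operators on H. *)
Definition star_rep (A : cstar_algebra R) (H : hilbert_space)
    (pi : A -> H -> H) :=
  [/\ forall a, linear (pi a) /\ continuous (pi a),
      forall x, linear (fun a => pi a x),
      forall x, pi 1 x = x,
      forall a b x, pi (a * b) x = pi a (pi b x) &
      forall a x y, hdot H (pi a x) y = hdot H x (pi (cstar a) y)].

(* A finite sequence of pairs stands for the sum of the elementary tensors. *)
Definition tensor_dot (H K : hilbert_space) (x y : seq (H * K)) : C :=
  \sum_(p <- x) \sum_(q <- y) hdot H p.1 q.1 * hdot K p.2 q.2.

Definition tensor_act (A B : cstar_algebra R) (H K : hilbert_space)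
    (pi : A -> H -> H) (rho : B -> K -> K)
    (s : seq (A * B)) (x : seq (H * K)) : seq (H * K) :=
  [seq (pi p.1 q.1, rho p.2 q.2) | p <- s, q <- x].

(* ||(pi (x) rho)(s)|| <= c for all representations pi of A and rho of B. *)
Definition spatial_le (A B : cstar_algebra R) (s : seq (A * B)) (c : R) :=
  forall (H K : hilbert_space) (pi : A -> H -> H) (rho : B -> K -> K)
    (x : seq (H * K)), star_rep pi -> star_rep rho ->
    tensor_dot (tensor_act pi rho s x) (tensor_act pi rho s x) <=
    (c ^+ 2)%:C * tensor_dot x x.

(* The minimal tensor product of A and B: a C*-completion of the algebraic
   tensor product for the spatial norm (unique up to isomorphism). *)
Record min_tensor (A B : cstar_algebra R) := MinTensor {
  tensor_alg :> cstar_algebra R;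
  tens : A -> B -> tensor_alg;
  tens_linl : forall b, linear (tens^~ b);
  tens_linr : forall a, linear (tens a);
  tens1 : tens 1 1 = 1;
  tensM : forall a b a' b', tens a b * tens a' b' = tens (a * a') (b * b');
  tens_star : forall a b, cstar (tens a b) = tens (cstar a) (cstar b);
  tens_norm : forall (s : seq (A * B)) (c : R), 0 <= c ->
    cnorm (\sum_(p <- s) tens p.1 p.2) <= c <-> spatial_le s c;
  tens_dense :
    norm_dense (lin_span [set x | exists a b, x = tens a b]) }.

(* h = f (x) g *)
Definition tensor_map (A B A' B' : cstar_algebra R)
    (T : min_tensor A B) (T' : min_tensor A' B')
    (f : A -> A') (g : B -> B') (h : T -> T') :=
  star_hom h /\ forall a b, h (tens T a b) = tens T' (f a) (g b).

(* Minimal tensor products being given up to isomorphism, the two sides of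
   (id (x) d) d = (d (x) id) d are compared through the associator. *)
Definition coassociative (A : cstar_algebra R) (T : min_tensor A A)
    (d : A -> T) :=
  exists (TL : min_tensor T A) (TR : min_tensor A T)
    (dl : T -> TL) (dr : T -> TR) (assoc : TL -> TR),
  [/\ tensor_map d id dl, tensor_map id d dr,
      star_hom assoc /\ bijective assoc,
      forall a b c,
        assoc (tens TL (tens T a b) c) = tens TR a (tens T b c) &
      forall a, dr (d a) = assoc (dl (d a))].

(* A C*-algebra with a comultiplication; B(V) (x) A is 'M[A]_n, for V = C^n. *)
Record cqg_data := CqgData {
  cqg_alg : cstar_algebra R;
  cqg_tensor : min_tensor cqg_alg cqg_alg;
  comult : cqg_alg -> cqg_tensor }.

Section representations.
Variable G : cqg_data.
Local Notation A := (cqg_alg G).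

Definition mx_inverse n (U V : 'M[A]_n) : Prop :=
  U *m V = 1%:M /\ V *m U = 1%:M.

(* The entries of (id (x) delta)(U) = U_12 U_13 are
   delta(u_ij) = sum_k u_ik (x) u_kj. *)
Definition is_rep n (U : 'M[A]_n) : Prop :=
  (exists V, mx_inverse U V) /\
  forall i j, comult (U i j) = \sum_k tens (cqg_tensor G) (U i k) (U k j).

Record rep := Rep {
  rep_dim : nat;
  rep_mx :> 'M[A]_rep_dim;
  rep_isrep : is_rep rep_mx }.

Definition unitary n (U : 'M[A]_n) : Prop :=
  mx_inverse U (map_mx (@cstar R A) U^T).

Definition mx1 m n (T : 'M[C]_(m, n)) : 'M[A]_(m, n) :=
  map_mx (fun c => c *: (1 : A)) T.

Definition mor m n (U : 'M[A]_m) (V : 'M[A]_n) : set 'M[C]_(n, m) :=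
  [set T | mx1 T *m U = V *m mx1 T].

Definition endo n (U : 'M[A]_n) : set 'M[C]_n := mor U U.

Definition irreducible n (U : 'M[A]_n) : Prop :=
  (0 < n)%N /\ endo U = [set T | exists c : C, T = c%:M].

Definition irr_unitary (U : rep) : Prop := unitary U /\ irreducible U.

Definition equivalent (U V : rep) : Prop :=
  exists (T : 'M[C]_(rep_dim V, rep_dim U)) (T' : 'M[C]_(rep_dim U, rep_dim V)),
    [/\ mor U V T, T *m T' = 1%:M & T' *m T = 1%:M].

(* The number of summands equivalent to rho in a decomposition of U into an
   orthogonal direct sum of irreducible representations. *)
Definition multiplicity n (U : 'M[A]_n) (rho : rep) (m : nat) : Prop :=
  exists (k : nat) (x : 'I_k -> rep) (T : forall i, 'M[C]_(n, rep_dim (x i))),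
  [/\ forall i, irr_unitary (x i) /\ mor (x i) U (T i),
      forall i, (T i)^t* *m T i = 1%:M,
      forall i j, i != j -> (T i)^t* *m T j = 0,
      \sum_i T i *m (T i)^t* = 1%:M &
      m = #|[pred i | `[< equivalent (x i) rho >]]| ].

(* Uc is the contragredient (j (x) id)(U^-1). *)
Definition is_contragredient n (U Uc : 'M[A]_n) : Prop :=
  exists2 V, mx_inverse U V & Uc = V^T.

Definition posdefmx n (F : 'M[C]_n) : Prop :=
  F \in unitmx /\ forall x : 'cV[C]_n, 0 <= (x^t* *m F *m x) 0 0.

Definition is_F n (U : 'M[A]_n) (F : 'M[C]_n) : Prop :=
  [/\ exists Uc Ucc, [/\ is_contragredient U Uc, is_contragredient Uc Ucc &
                         mor U Ucc F],
      posdefmx F &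
      forall T, endo U T -> \tr (F *m T) = \tr (invmx F *m T)].

Definition matrix_coefs : set A :=
  lin_span [set a | exists (U : rep) i j, a = U i j].

Definition is_cqg : Prop :=
  let d := @comult G in let T := cqg_tensor G in
  [/\ star_hom d,
      coassociative d,
      norm_dense (lin_span [set x | exists a b, x = d a * tens T b 1]) /\
      norm_dense (lin_span [set x | exists a b, x = d a * tens T 1 b]) &
      forall (B : cstar_algebra R) (f : A -> B),
        star_hom_on matrix_coefs f ->
        exists2 g : A -> B, star_hom g /\ {in matrix_coefs, g =1 f} &
          forall g' : A -> B, star_hom g' -> {in matrix_coefs, g' =1 f} ->
            g' =1 g].

Definition countable_dual : Prop :=
  exists u : nat -> rep, forall U, irr_unitary U -> exists n, equivalent U (u n).

End representations.

(* G_0 = (C, id): as cqg_alg (GG 0) is a nonzero algebra, it is C as soon as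
   all its elements are scalars. *)
Record inductive_system := InductiveSystem {
  qgroup :> nat -> cqg_data;
  theta : forall N, cqg_alg (qgroup N.+1) -> cqg_alg (qgroup N);
  qgroup_cqg : forall N, is_cqg (qgroup N);
  qgroup0 : forall a : cqg_alg (qgroup 0), exists c : C, a = c *: 1;
  qgroup_countable : forall N, countable_dual (qgroup N);
  theta_hom : forall N, star_hom (@theta N);
  theta_surj : forall N (a : cqg_alg (qgroup N)), exists b, theta b = a;
  theta_comult : forall N,
    exists2 th : cqg_tensor (qgroup N.+1) -> cqg_tensor (qgroup N),
      tensor_map (@theta N) (@theta N) th &
      forall a, comult (theta a) = th (comult a) }.

Section associated.
Variables (GG : inductive_system) (G : branching_graph) (w : edge G -> R).

Definition restr N (U : rep (GG N.+1)) : 'M[cqg_alg (GG N)]_(rep_dim U) :=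
  map_mx (@theta GG N) U.

(* U N v, for v in V_N, are the chosen representatives of the classes of
   irreducible unitary representations of G_N. *)
Definition represents_dual (U : forall N, vertex G -> rep (GG N)) : Prop :=
  forall N,
  [/\ forall v, V_ N v -> irr_unitary (U N v),
      forall x, irr_unitary x -> exists2 v, V_ N v & equivalent x (U N v) &
      forall u v, V_ N u -> V_ N v -> equivalent (U N u) (U N v) -> u = v].

(* The edge e is [src e, lab e, rng e]. *)
Definition labels_edges (U : forall N, vertex G -> rep (GG N))
    (lab : edge G -> nat) : Prop :=
  forall N rho pi, V_ N rho -> V_ N.+1 pi ->
  exists2 m, multiplicity (restr (U N.+1 pi)) (U N rho) m &
    set_bij [set e | E_ N.+1 e /\ src e = rho /\ rng e = pi]
            [set l | (1 <= l <= m)%N] lab.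

(* S N pi e, for e in E_N.+1 of range pi, is the intertwiner S_e. *)
Definition weights_from_W (U : forall N, vertex G -> rep (GG N))
    (lab : edge G -> nat) : Prop :=
  exists S : forall N (pi : vertex G) (e : edge G),
    'M[C]_(rep_dim (U N.+1 pi), rep_dim (U N (src e))),
  forall N pi, V_ N.+1 pi ->
  exists (F Fr W : 'M[C]_(rep_dim (U N.+1 pi))),
  [/\ is_F (U N.+1 pi) F,
      is_F (restr (U N.+1 pi)) Fr,
      [/\ endo (restr (U N.+1 pi)) W, posdefmx W, F = W *m Fr & F = Fr *m W],
      [/\ forall e, rng e = pi ->
            mor (U N (src e)) (restr (U N.+1 pi)) (S N pi e),
          forall e, rng e = pi -> (S N pi e)^t* *m S N pi e = 1%:M,
          forall e e', rng e = pi -> rng e' = pi -> e != e' ->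
            (S N pi e)^t* *m S N pi e' = 0 &
          \sum_(e \in @rng G @^-1` [set pi]) S N pi e *m (S N pi e)^t* = 1%:M] &
      W = \sum_(e \in @rng G @^-1` [set pi])
            (w e)%:C *: (S N pi e *m (S N pi e)^t*) /\
      forall e e', rng e = pi -> rng e' = pi -> src e = src e' ->
        (lab e <= lab e')%N -> w e <= w e'].

Definition associated : Prop :=
  exists (U : forall N, vertex G -> rep (GG N)) (lab : edge G -> nat),
  [/\ represents_dual U, labels_edges U lab & weights_from_W U lab].

End associated.
End cstar.

(* Main.v *)
(** The idea is a maximal inequality for the tail events of the path space.
    Let t be a path from the root to v, and let A be an event that depends only
    on the path beyond level N.  By centrality, exchanging two initial segments
    p, q with the same end vertex rescales P by w(q)/w(p), so on
    A /\ {X_N = u} the cylinder C_t has relative weight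
    w(t) w-dim(v,u)/w-dim(u).  Cutting the event {w-dim(v,X_N)/w-dim(X_N) > b
    for some N >= n} according to the last such N, and letting the horizon tend
    to infinity, shows that its probability times b w(t) is at most that of its
    intersection with C_t.  The event that this happens for infinitely many N is
    invariant, hence null by ergodicity unless b w(t) <= P(C_t); the lower bound
    is symmetric.  Since there are countably many vertices and the bounds
    b = P(C_t)/w(t) +- 1/k suffice, almost every path works.
    For an extremal central P, conditioning on an invariant event and on its
    complement gives central measures, so P is ergodic. *)
Require Import Defs.
From mathcomp Require Import all_boot all_order all_algebra.
From mathcomp Require Import all_classical all_reals all_analysis.

Set Implicit Arguments.
Unset Strict Implicit.
Unset Printing Implicit Defensive.

Import Order.TTheory GRing.Theory Num.Theory.
Import numFieldNormedType.Exports.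
Local Open Scope classical_set_scope.
Local Open Scope ring_scope.

Local Notation root := Defs.root.

(** * Finite paths and their levels *)

Section graph.
Variable G : branching_graph.
Implicit Types (u v : vertex G) (e : edge G) (s t p q : seq (edge G)).
Implicit Types (om : path_space G) (A B : set (path_space G)).

Lemma is_path_cat u s t v :
  is_path u (s ++ t) v <-> exists2 x, is_path u s x & is_path x t v.
Proof.
elim: s u => [|e s IH] u /=.
  by split=> [h|[x -> //]]; exists u.
split=> [[ue /IH[x sx tx]]|[x [ue sx] tx]]; first by exists x.
by split=> //; apply/IH; exists x.
Qed.

Lemma is_path_uniq u t v v' : is_path u t v -> is_path u t v' -> v = v'.
Proof.
by elim: t u => [u <- <-|e t IH u [_ h1] [_ h2]] //; exact: IH h1 h2.
Qed.

Lemma is_path_catr u s t x v :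
  is_path u s x -> is_path u (s ++ t) v -> is_path x t v.
Proof. by move=> h /is_path_cat[y /(is_path_uniq h) <-]. Qed.

Lemma vlevel_rng e : vlevel (rng e) = (vlevel (src e)).+1.
Proof.
have := elevel_gt0 e; case E: (elevel e) => [//|N] _.
have : [set v | vlevel v = N.+1] (rng e) by rewrite -rng_level; exists e.
have : [set v | vlevel v = N] (src e) by rewrite -src_level; exists e.
by move=> /= -> ->.
Qed.

Lemma vlevel_root : vlevel (root G) = 0%N.
Proof.
have : [set root G] (root G) by [].
by rewrite -vlevel0.
Qed.

Lemma vlevel_path u t v : is_path u t v -> vlevel v = (vlevel u + size t)%N.
Proof.
elim: t u => [u <-|e t IH u [<- /IH ->]] /=; first by rewrite addn0.
by rewrite vlevel_rng addnS addSn.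
Qed.

Lemma size_root_path t v : is_path (root G) t v -> size t = vlevel v.
Proof. by move=> /vlevel_path ->; rewrite vlevel_root. Qed.

Lemma root_path v : exists t, is_path (root G) t v.
Proof.
move E: (vlevel v) => N; elim: N v E => [|N IH] v E.
  exists [::] => /=; suff : [set root G] v by [].
  by rewrite -vlevel0.
have : [set v | vlevel v = N.+1] v by [].
rewrite -rng_level => -[e /= Ee ev].
have [t ht] : exists t, is_path (root G) t (src e).
  by apply: IH; move: E; rewrite -ev vlevel_rng => -[].
by exists (rcons t e); rewrite -cats1; apply/is_path_cat; exists (src e).
Qed.

(** The levels of [u] and [v] fix the length. The induction on the length peels off the last edge,
    because [finite_rng] bounds the edges entering a vertex while a vertex may emit infinitely
    many. *)
Lemma finite_paths u v : finite_set (paths u v).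
Proof.
suff H n x : finite_set [set t | is_path u t x /\ size t = n].
  apply: sub_finite_set (H (vlevel v - vlevel u)%N v) => t ut /=.
  by split=> //; rewrite (vlevel_path ut) addKn.
elim: n x => [|n IH] x.
  apply: sub_finite_set (finite_set1 [::]) => t /= [_].
  by move/size0nil.
apply: sub_finite_set (_ : finite_set (\bigcup_(e in @rng G @^-1` [set x])
   [set rcons t e | t in [set t | is_path u t (src e) /\ size t = n]])).
  move=> t; case/lastP: t => [[]//|t e] /= [].
  rewrite -cats1 => /is_path_cat[y ty [ey ex]].
  rewrite size_cat addn1 => -[st].
  by exists e => //; exists t; rewrite ?cats1// ey.
apply: bigcup_finite; first exact: finite_rng.
by move=> e _; apply: finite_image.
Qed.

(** * Infinite paths, cylinders and tail events *)

Lemma path_space_ext om om' : (forall n, om n = om' n) -> om = om'.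
Proof.
case: om om' => [f f0 fc] [g g0 gc] /= /funext fg; subst g.
by rewrite (Prop_irrelevance f0 g0) (Prop_irrelevance fc gc).
Qed.

Lemma src_pedge om n : src (om n) = X n om.
Proof. by case: n => [|n]; [exact: pedge_root|rewrite -pedge_consecutive]. Qed.

Lemma is_path_mkseq om n : is_path (root G) (mkseq om n) (X n om).
Proof.
elim: n => [//|n IH]; rewrite mkseqS -cats1.
by apply/is_path_cat; exists (X n om) => //=; rewrite src_pedge.
Qed.

Lemma vlevel_X om n : vlevel (X n om) = n.
Proof. by rewrite -(size_root_path (is_path_mkseq om n)) size_mkseq. Qed.

Lemma X_cylinder t v om : is_path (root G) t v -> cylinder t om ->
  X (size t) om = v.
Proof.
move=> tv /= omt; apply: is_path_uniq tv.
by rewrite -{1}omt; exact: is_path_mkseq.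
Qed.

Lemma mkseq_prefix om m n : (m <= n)%N ->
  mkseq om m = take m (mkseq om n).
Proof. by move=> mn; rewrite /mkseq -map_take take_iota (minn_idPl mn). Qed.

Lemma cylinder_prefix p s : cylinder (p ++ s) `<=` @cylinder G p.
Proof.
move=> om; rewrite /cylinder /= => h.
rewrite (@mkseq_prefix _ _ (size (p ++ s))) ?h ?take_size_cat//.
by rewrite size_cat leq_addr.
Qed.

Lemma cylinder_nil : @cylinder G [::] = setT.
Proof. by apply/seteqP; split. Qed.

Lemma cylinder_disj p q om :
  size p = size q -> cylinder p om -> cylinder q om -> p = q.
Proof. by rewrite /cylinder /= => -> -> . Qed.

Lemma cylinderI p q : (size p <= size q)%N ->
  cylinder p `&` cylinder q = set0 \/
  (cylinder p `&` cylinder q = @cylinder G q /\ exists s, q = p ++ s).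
Proof.
move=> pq; have [E|E] := pselect (p = take (size p) q); last first.
  left; apply/seteqP; split=> // om [/= hp hq]; apply: E.
  by rewrite -hq -mkseq_prefix.
have qE : q = p ++ drop (size p) q by rewrite {1}E cat_take_drop.
right; split; last by exists (drop (size p) q).
apply/seteqP; split=> [om []//|om hq]; split=> //.
by move: hq; rewrite qE; exact: cylinder_prefix.
Qed.

(** If [t] leads from the root to the vertex of [om] at level [size t], it can replace the initial
    segment of [om]; otherwise [om] is kept, which makes the map total. The default [om n] of [nth]
    supplies the edges after [t]. *)
Lemma reroute_ex t om : exists om' : path_space G, forall n,
  om' n = if `[< is_path (root G) t (X (size t) om) >] then nth (om n) t n
          else om n.
Proof.
case: asboolP => [h|_]; last by exists om.
pose f n := nth (om n) t n.
have fE n : f n = if (n < size t)%N then nth (om 0%N) t n else om n.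
  rewrite /f; case: ltnP => nt; first exact: set_nth_default.
  by rewrite nth_default.
(* The cases are: inside [t], then beyond [t], where the junction ([size t] equal to [n.+1]) uses
   that [t] ends at the vertex of [om]. *)
have fsrc n : src (f n) = if n is n'.+1 then rng (f n') else root G.
  have [nt|nt] := ltnP n (size t).
    have := h; rewrite -(cat_take_drop n t) => /is_path_cat[x].
    rewrite (drop_nth (om n) nt) /= => tx [sx _].
    rewrite sx.
    case: n nt tx sx => [|n] nt tx sx; first by rewrite take0 in tx.
    move: tx; rewrite (take_nth (om n)) ?(ltnW nt)// -cats1.
    by move=> /is_path_cat[y _ []].
  rewrite fE ltnNge nt /= src_pedge; case: n nt => [//|n] nt.
  rewrite fE; case: ltnP => nt' //=.
  have E : size t = n.+1 by apply/eqP; rewrite eqn_leq nt.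
  have : is_path (root G) (take n.+1 t) (X n.+1 om) by rewrite -E take_size.
  by rewrite (take_nth (om 0%N))// -cats1 => /is_path_cat[y _ [_ /= ->]].
by exists (@PathSpace G f (fsrc 0%N) (fun n => esym (fsrc n.+1))).
Qed.

Definition reroute t om : path_space G := projT1 (cid (reroute_ex t om)).

Lemma rerouteE t om n : reroute t om n =
  if `[< is_path (root G) t (X (size t) om) >] then nth (om n) t n else om n.
Proof. by rewrite /reroute; case: cid. Qed.

Lemma reroute_cylinder t om : is_path (root G) t (X (size t) om) ->
  cylinder t (reroute t om).
Proof.
move=> h; apply: (@eq_from_nth _ (om 0%N)); rewrite size_mkseq// => i it.
by rewrite nth_mkseq// rerouteE asboolT//; exact: set_nth_default.
Qed.

Lemma reroute_tail t om n : (size t <= n)%N -> reroute t om n = om n.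
Proof. by move=> tn; rewrite rerouteE nth_default// if_same. Qed.

Lemma mkseq_eqP om om' m :
  mkseq om m = mkseq om' m <-> forall k, (k < m)%N -> om k = om' k.
Proof.
split=> [h k km|h].
  by have := congr1 (fun s => nth (om 0%N) s k) h; rewrite !nth_mkseq.
by apply/eq_in_map => k; rewrite mem_iota => /andP[_ /h].
Qed.

Lemma X_mkseq om om' n : mkseq om n = mkseq om' n -> X n om = X n om'.
Proof.
move=> h; apply: (is_path_uniq (is_path_mkseq om n)).
by rewrite h; exact: is_path_mkseq.
Qed.

(** Rerouting keeps the edges beyond the common length of [p] and [q], so both memberships amount to
    the same condition on those edges. *)
Lemma cylinder_reroute p q s v om : is_path (root G) p v ->
  is_path (root G) q v -> size p = size q ->
  cylinder p om -> cylinder (q ++ s) (reroute q om) <-> cylinder (p ++ s) om.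
Proof.
move=> pv qv pq omp.
have h : is_path (root G) q (X (size q) om) by rewrite -pq (X_cylinder pv).
have H t : is_path (root G) t v -> size t = size q -> forall om1,
    (forall n, (size q <= n)%N -> om1 n = om n) -> cylinder t om1 ->
    cylinder (t ++ s) om1 <-> forall k, (k < size s)%N ->
      om (size q + k)%N = nth (om 0%N) s k.
  move=> tv tq om1 om1E om1t; split=> [h1 k ks|h1].
    rewrite -om1E ?leq_addr//.
    have := congr1 (fun s => nth (om 0%N) s (size q + k)) h1.
    rewrite nth_mkseq ?size_cat ?tq ?ltn_add2l// => ->.
    by rewrite nth_cat tq ltnNge leq_addr /= addKn.
  apply: (@eq_from_nth _ (om 0%N)); rewrite size_mkseq// => i.
  rewrite size_cat tq => it; rewrite nth_mkseq ?size_cat ?tq// nth_cat tq.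
  case: ltnP => iq; first by rewrite -[X in nth _ X]om1t nth_mkseq ?tq.
  by rewrite om1E// -h1 ?subnKC// ltn_subLR.
apply: (iff_trans (H _ qv _ _ _ _)) => //; first by move=> n; exact: reroute_tail.
  exact: reroute_cylinder.
by apply: iff_sym; apply: H.
Qed.

(** The code turns partitions and almost sure statements indexed by vertices into ones indexed by
    natural numbers. *)
Lemma vertex_code : exists code : vertex G -> nat, injective code.
Proof.
have : countable [set: vertex G].
  have -> : [set: vertex G] = \bigcup_N V_ N.
    by apply/seteqP; split=> // v _; exists (vlevel v).
  by apply: bigcup_countable => // N _; exact: countable_vlevel.
by move=> /countable_injP[f finj]; exists f => x y; apply: finj; rewrite inE.
Qed.

Lemma measurable_cylinder t v : is_path (root G) t v ->
  measurable (cylinder t : set (Omega G)).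
Proof. by move=> tv; apply: sub_sigma_algebra; exists t => //; exists v. Qed.

(** Such an event is a union of cylinders of length [m], grouped by end vertex: countably many
    vertices, finitely many paths to each. *)
Lemma measurable_prefix m A :
  (forall om om', mkseq om m = mkseq om' m -> A om -> A om') ->
  measurable (A : set (Omega G)).
Proof.
move=> Am.
pose D u := [set t | is_path (root G) t u /\
  size t = m /\ exists2 om, A om & mkseq om m = t].
have -> : A = \bigcup_u \bigcup_(t in D u) cylinder t.
  apply/seteqP; split=> [om Aom|om [u _ [t [tu [tm [om' Aom' tE]]]]]].
    exists (X m om) => //; exists (mkseq om m); last first.
      by rewrite /cylinder /= size_mkseq.
    by split; [exact: is_path_mkseq|rewrite size_mkseq; split=> //; exists om].
  by rewrite /cylinder /= tm -tE => /esym h; exact: Am h Aom'.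
apply: countable_bigcupT_measurable => [|u].
  by have [f fi] := vertex_code; apply/countable_injP; exists f => x y _ _ /fi.
apply: fin_bigcup_measurable => [|t [tu _]]; last exact: measurable_cylinder tu.
by apply: sub_finite_set (finite_paths (root G) u) => t [].
Qed.

Lemma measurable_X N (Q : vertex G -> Prop) :
  measurable ([set om | Q (X N om)] : set (Omega G)).
Proof.
by apply: (@measurable_prefix N) => om om' /X_mkseq /= ->.
Qed.

Lemma measurable_reroute t :
  measurable_fun setT (reroute t : Omega G -> Omega G).
Proof.
apply: (measurability (@cylinders G : set (set (Omega G)))) => // _ [_ [s _ ->] <-].
rewrite setTI.
apply: (@measurable_prefix (maxn (size t) (size s))) => om om' /mkseq_eqP h.
rewrite /preimage /cylinder /= => sE; rewrite -[RHS]sE.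
apply/mkseq_eqP => k ks.
have E : X (size t) om = X (size t) om'.
  apply: X_mkseq; apply/mkseq_eqP => i it; apply: h.
  by rewrite (leq_trans it)// leq_maxl.
by rewrite !rerouteE E h// (leq_trans ks)// leq_maxr.
Qed.

(** Since edges are numbered from 0, the edges of index at least [N] are those leaving level [N] and
    beyond. They determine [X N], the source of edge [N]. *)
Definition tail_invariant N A := forall om om',
  (forall n, (N <= n)%N -> om n = om' n) -> A om -> A om'.

Lemma tail_invariantC N A : tail_invariant N A -> tail_invariant N (~` A).
Proof.
by move=> h om om' E nA Aom'; apply: nA; apply: (h om' om) Aom' => n /E.
Qed.

Lemma tail_invariant_X N (Q : vertex G -> Prop) :
  tail_invariant N [set om | Q (X N om)].
Proof. by move=> om om' /(_ N (leqnn _)) /=; rewrite -!src_pedge => ->. Qed.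

(** Two paths that agree from level [N] on pass through the same vertex there, so the transposition
    of their initial segments is an elementary transformation carrying one to the other. *)
Lemma perm_invariant_tail N A :
  (forall g, elementary N g -> g @` A = A) -> tail_invariant N A.
Proof.
move=> inv om om' E Aom.
set p := mkseq om N; set q := mkseq om' N; set u := X N om.
have uE : X N om' = u by rewrite /u -!src_pedge E.
have pu : is_path (root G) p u by exact: is_path_mkseq.
have qu : is_path (root G) q u by rewrite -uE; exact: is_path_mkseq.
have sp : size p = N by rewrite size_mkseq.
have sq : size q = N by rewrite size_mkseq.
(* [g] is the action on infinite paths of the transposition [gamma] of [p] and [q]. *)
pose g (x : path_space G) := if mkseq x N == p then reroute q x
            else if mkseq x N == q then reroute p x else x.
pose gamma t := if t == p then q else if t == q then p else t.
have gammaK : involutive gamma.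
  move=> t; rewrite /gamma.
  have [->|tp] := eqVneq t p; first by rewrite eqxx; case: eqVneq.
  have [->|tq] := eqVneq t q; first by rewrite eqxx.
  by rewrite (negPf tp) (negPf tq).
have gammaP t : is_path (root G) t u -> is_path (root G) (gamma t) u.
  by rewrite /gamma; case: eqVneq => // _; case: eqVneq.
have gu x : X N x = u -> mkseq (g x) N = gamma (mkseq x N) /\
    forall n, (N <= n)%N -> g x n = x n.
  move=> xu; rewrite /g /gamma; case: eqVneq => _; last case: eqVneq => _ //.
    split=> [|n Nn]; last by rewrite reroute_tail ?sq.
    by have := @reroute_cylinder q x; rewrite /cylinder /= sq xu; apply.
  split=> [|n Nn]; last by rewrite reroute_tail ?sp.
  by have := @reroute_cylinder p x; rewrite /cylinder /= sp xu; apply.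
rewrite -(inv g); last first.
  exists u; first exact: vlevel_X.
  exists gamma.
    split=> [t /gammaP//|t t' _ _ /(can_inj gammaK)//|t tu].
    by exists (gamma t) => //; exact: gammaP.
  move=> x; split=> [|xu]; first exact: gu.
  rewrite /g; case: eqVneq => [E'|_].
    by case: xu; apply: is_path_uniq pu; rewrite -E'; exact: is_path_mkseq.
  case: eqVneq => [E'|//].
  by case: xu; apply: is_path_uniq qu; rewrite -E'; exact: is_path_mkseq.
exists om => //; have [g1 g2] := gu om erefl.
apply: path_space_ext => n; have [nN|Nn] := ltnP n N; last by rewrite g2// E.
by move: g1; rewrite /gamma eqxx => /mkseq_eqP ->.
Qed.

(** Every transformation in [perm_group N] is onto and changes only the first [N] edges. Both
    properties pass through the generation of the group, and together they give the equality of
    image and set. *)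
Lemma tail_perm_invariant A : (forall N, tail_invariant N A) ->
  forall g, perm_group_inf g -> g @` A = A.
Proof.
move=> tA g [N _ gN].
suff [gs gE] : (forall y, exists x, g x = y) /\
    forall x n, (N <= n)%N -> g x n = x n.
  apply/seteqP; split=> [_ [x Ax <-]|y Ay].
    by apply: (tA N) Ax => n Nn; rewrite gE.
  by have [x xy] := gs y; exists x => //; apply: (tA N) Ay => n Nn; rewrite -xy gE.
elim: gN => {g} [|g|g h _ [gs gE] _ [hs hE]|g h _ [gs gE] gK hK].
- by split=> // y; exists y.
- case=> v Vv [gamma [gf ginj gsurj] gact].
  split=> [y|x n Nn].
    have [yv|yv] := pselect (X N y = v); last by exists y; have [_ ->] := gact y.
    have [t tv tE] : (gamma @` paths (root G) v) (mkseq y N).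
      by apply: gsurj; rewrite /paths /= -yv; exact: is_path_mkseq.
    have tN : size t = N by rewrite (size_root_path tv).
    have h : is_path (root G) t (X (size t) y) by rewrite tN yv.
    have tc : mkseq (reroute t y) N = t by rewrite -tN; exact: reroute_cylinder.
    exists (reroute t y).
    have rv : X N (reroute t y) = v.
      by rewrite -tN; apply: (X_cylinder tv); rewrite /cylinder /= tN.
    have [/(_ rv)[g1 g2] _] := gact (reroute t y).
    apply: path_space_ext => n; have [nN|Nn] := ltnP n N.
      by move: n nN; apply/mkseq_eqP; rewrite g1 tc.
    by rewrite g2// reroute_tail ?tN.
  have [h1 h2] := gact x.
  by have [/h1[_ ->]|/h2 ->] := pselect (X N x = v).
- split=> [y|x n Nn /=]; last by rewrite gE// hE.
  by have [z zy] := gs y; have [x xz] := hs z; exists x => /=; rewrite xz.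
- split=> [y|x n Nn]; first by exists (g y); rewrite gK.
  by rewrite -[RHS](congr1 (fun z : path_space G => z n) (hK x)) gE.
Qed.

End graph.

(** * Consequences of centrality for tail events *)

Section measures.
Variables (R : realType) (G : branching_graph) (w : edge G -> R).
Hypothesis w_gt0 : forall e, 0 < w e.
Implicit Types (u v : vertex G) (t p q s : seq (edge G)).
Implicit Types (P : probability (Omega G) R) (A : set (Omega G)).

Lemma wpath_gt0 t : 0 < wpath w t.
Proof. exact: prodr_gt0. Qed.

Lemma wpath_cat s t : wpath w (s ++ t) = wpath w s * wpath w t.
Proof. by rewrite /wpath big_cat. Qed.

Lemma wdim_ge0 u v : 0 <= wdim w u v.
Proof. by apply: fsumr_ge0 => t _; exact: ltW (wpath_gt0 t). Qed.

Lemma wdim0_gt0 v : 0 < wdim0 w v.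
Proof.
have [t tv] := root_path v.
rewrite /wdim0 /wdim (fsbigD1 t)//; last exact: finite_paths.
rewrite ltr_pwDl ?wpath_gt0//; apply: fsumr_ge0 => s _.
exact: ltW (wpath_gt0 s).
Qed.

(** The right-hand side in [central] depends on the end vertex only; equate it for [p] and [q] and
    clear denominators. *)
Lemma central_cylinder P p q v : central w P ->
  is_path (root G) p v -> is_path (root G) q v -> (1 <= vlevel v)%N ->
  ((wpath w q)%:E * P (cylinder p) = (wpath w p)%:E * P (cylinder q))%E.
Proof.
move=> cP pv qv v1.
have mp := measurable_cylinder pv; have mq := measurable_cylinder qv.
rewrite -(fineK (fin_num_measure P _ mp)) -(fineK (fin_num_measure P _ mq)).
rewrite -!EFinM; congr (_%:E).
have E := etrans (cP _ _ _ v1 erefl pv) (esym (cP _ _ _ v1 erefl qv)).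
move/eqP: E; rewrite eqr_div ?(gt_eqF (wpath_gt0 _))// => /eqP E.
by rewrite mulrC E mulrC.
Qed.

(** Two cylinders are nested or disjoint, so cylinders together with the empty set are stable under
    intersection and the uniqueness theorem for measures applies. *)
Lemma cylinders_unique (m1 m2 : {measure set (Omega G) -> \bar R}) :
  (m1 setT < +oo)%E ->
  (forall t v, is_path (root G) t v -> m1 (cylinder t) = m2 (cylinder t)) ->
  forall A, measurable A -> m1 A = m2 A.
Proof.
move=> m1oo m12 A mA.
pose H := [set B | cylinders B \/ B = set0] : set (set (Omega G)).
have HT : H setT.
  by left; exists [::]; [exists (root G)|rewrite cylinder_nil].
apply: (measure_unique H (fun=> setT)) => //.
- apply/seteqP; split.
    by apply: sub_sigma_algebra2 => B; left.
  apply: smallest_sub; first exact: sigma_algebra_measurable.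
  by move=> B [HB|->]; [exact: sub_sigma_algebra|exact: measurable0].
- have cI p q v : is_path (root G) q v -> (size p <= size q)%N ->
      H (cylinder p `&` cylinder q).
    move=> qv pq; have [->|[-> _]] := cylinderI pq; first by right.
    by left; exists q => //; exists v.
  move=> B1 B2 [[p [v1 pv] ->]|->]; last by rewrite set0I; right.
  move=> [[q [v2 qv] ->]|->]; last by rewrite setI0; right.
  have [pq|/ltnW pq] := leqP (size p) (size q); first exact: cI qv pq.
  by rewrite setIC; exact: cI pv pq.
- exact: bigcup_const.
- by move=> B [[t [v tv] ->]|->]; [exact: m12 tv|rewrite !measure0].
Qed.

(** Exchanging [p] for [q] rescales [P] by a constant factor. Both sides become measures of [A], the
    left one through a pushforward by [reroute q], and these are compared on cylinders. *)
Lemma central_swap P N u p q A : central w P -> (1 <= N)%N -> V_ N u ->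
  is_path (root G) p u -> is_path (root G) q u -> measurable A ->
  tail_invariant N A ->
  ((wpath w q)%:E * P (A `&` cylinder p) =
   (wpath w p)%:E * P (A `&` cylinder q))%E.
Proof.
move=> cP N1 uN pu qu mA tA.
have mp := measurable_cylinder pu; have mq := measurable_cylinder qu.
have spq : size p = size q by rewrite !(@size_root_path _ _ u).
have sp : size p = N by rewrite (size_root_path pu).
have sq : size q = N by rewrite -spq.
have pos t : 0 <= wpath w t by exact: ltW (wpath_gt0 t).
pose m1 := mscale (NngNum (pos q))
  (pushforward (mrestr P mp) (reroute q : Omega G -> Omega G)).
pose m2 := mscale (NngNum (pos p)) (mrestr P mq).
have rq om : cylinder p om -> cylinder q (reroute q om).
  by move=> omp; apply: reroute_cylinder; rewrite -spq (X_cylinder pu).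
(* Tail invariance enters here: rerouting does not affect membership in [A]. *)
have -> : A `&` cylinder p = reroute q @^-1` A `&` cylinder p.
  apply/seteqP; split=> om [Aom omp]; split=> //; apply: (tA) Aom => n Nn;
  by rewrite reroute_tail ?sq.
apply: (@cylinders_unique (m1 (@measurable_reroute G q)) m2) mA => [|t v tv].
  rewrite /= /mscale /= /pushforward /= /mrestr /=.
  rewrite preimage_setT setTI lte_mul_pinfty ?lee_fin//.
  by rewrite (le_lt_trans (probability_le1 P mp)) ?ltry.
rewrite /= /mscale /= /pushforward /= /mrestr /=.
have cup : (1 <= vlevel u)%N by rewrite uN.
have pq0 : cylinder t `&` cylinder q = @set0 (path_space G) ->
    reroute q @^-1` cylinder t `&` cylinder p = set0.
  move=> tq; apply/seteqP; split=> // om [omt omp].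
  have : (cylinder t `&` cylinder q) (reroute q om) by split=> //; exact: rq.
  by rewrite tq.
(* A cylinder of [t] no longer than [q] contains that of [q] or misses it. If [t] is [q ++ s], its
   preimage within the cylinder of [p] is the cylinder of [p ++ s], and the common factor
   [wpath w s] cancels. *)
have [tq|qt] := leqP (size t) (size q).
  have [E|[E _]] := cylinderI tq; first by rewrite E (pq0 E) !measure0 !mule0.
  rewrite E (_ : _ `&` _ = cylinder p); first exact: central_cylinder pu qu _.
  apply/seteqP; split=> [om []//|om omp]; split=> //.
  by have := rq _ omp; rewrite -E => -[].
have [E|[E [s ts]]] := cylinderI (ltnW qt).
  by rewrite setIC in E; rewrite E (pq0 E) !measure0 !mule0.
rewrite setIC in E; rewrite E.
move: tv E; rewrite {}ts => qsv E.
have sv := is_path_catr qu qsv.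
have psv : is_path (root G) (p ++ s) v by apply/is_path_cat; exists u.
rewrite (_ : _ `&` _ = cylinder (p ++ s)); last first.
  apply/seteqP; split=> om.
    move=> [qs omp]; move: qs.
    by rewrite /preimage /= (cylinder_reroute s pu qu).
  move=> omps; have omp := cylinder_prefix omps.
  by split=> //; rewrite /preimage /= (cylinder_reroute s pu qu).
have := central_cylinder cP psv qsv _.
rewrite !wpath_cat (vlevel_path qsv) vlevel_root size_cat sq.
move=> /(_ (leq_trans N1 (leq_addr _ _))).
have mps := measurable_cylinder psv; have mqs := measurable_cylinder qsv.
rewrite -(fineK (fin_num_measure P _ mps)) -(fineK (fin_num_measure P _ mqs)).
move/eqP; rewrite -!EFinM eqe => /eqP /= h; congr (_%:E).
apply: (mulIf (lt0r_neq0 (wpath_gt0 s))).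
by rewrite mulrAC h mulrAC.
Qed.

Lemma tail_slice P N u A : central w P -> (1 <= N)%N -> V_ N u ->
  measurable A -> tail_invariant N A ->
  exists c : R, forall p, is_path (root G) p u ->
    P (A `&` cylinder p) = (c * wpath w p)%:E.
Proof.
move=> cP N1 uN mA tA; have [q qu] := root_path u.
have mC p : is_path (root G) p u -> measurable (A `&` cylinder p).
  by move=> pu; apply: measurableI => //; exact: measurable_cylinder pu.
exists (fine (P (A `&` cylinder q)) / wpath w q) => p pu.
have := central_swap cP N1 uN pu qu mA tA.
rewrite -(fineK (fin_num_measure P _ (mC _ pu))).
rewrite -(fineK (fin_num_measure P _ (mC _ qu))) /=.
move/eqP; rewrite -!EFinM eqe => /eqP h; congr (_%:E).
apply: (mulfI (lt0r_neq0 (wpath_gt0 q))).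
by rewrite h [RHS]mulrA [X in _ = X * _]mulrCA divff ?mulr1 ?gt_eqF ?wpath_gt0// mulrC.
Qed.

(** Paths from the root to [u] have equal length, so their cylinders are disjoint. The set [D] will
    be all of them, or those extending a given path. *)
Lemma tail_slice_sum P u A (c : R) (D : set (seq (edge G))) :
  measurable A ->
  (forall p, is_path (root G) p u ->
    P (A `&` cylinder p) = (c * wpath w p)%:E) -> D `<=` paths (root G) u ->
  P (A `&` \bigcup_(p in D) cylinder p) = (c * \sum_(p \in D) wpath w p)%:E.
Proof.
move=> mA h Du.
have fD : finite_set D := sub_finite_set Du (finite_paths _ _).
rewrite setI_bigcupr measure_fin_bigcup//=; first last.
- by move=> p /Du pu; apply: measurableI => //; exact: measurable_cylinder pu.
- move=> p q /Du pu /Du qu [om [[_ h1] [_ h2]]].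
  by apply: cylinder_disj h1 h2; rewrite !(@size_root_path _ _ u).
rewrite mulr_fsumr -fsumEFin//; apply: eq_fsbigr => p; rewrite inE => /Du.
exact: h.
Qed.

Lemma X_bigcup N u : V_ N u ->
  [set om | X N om = u] = \bigcup_(p in paths (root G) u) @cylinder G p.
Proof.
move=> uN; apply/seteqP; split=> [om /= omu|om [p pu omp] /=].
  exists (mkseq om N); first by rewrite /paths /= -omu; exact: is_path_mkseq.
  by rewrite /cylinder /= size_mkseq.
by rewrite -(X_cylinder pu omp) (size_root_path pu) uN.
Qed.

Lemma X_bigcup_cylinder N u t v : V_ N u -> is_path (root G) t v ->
  (size t <= N)%N ->
  [set om | X N om = u] `&` cylinder t =
  \bigcup_(p in cat t @` paths v u) @cylinder G p.
Proof.
move=> uN tv tN; apply/seteqP; split=> [om [/= omu omt]|om [_ [s su <-] omts]].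
  exists (mkseq om N); last by rewrite /cylinder /= size_mkseq.
  have E : mkseq om N = t ++ drop (size t) (mkseq om N).
    by rewrite -{1}omt (mkseq_prefix _ tN) cat_take_drop.
  exists (drop (size t) (mkseq om N)); last by [].
  apply: (is_path_catr tv); rewrite -E -omu; exact: is_path_mkseq.
have tsu : is_path (root G) (t ++ s) u by apply/is_path_cat; exists v.
split; last exact: cylinder_prefix omts.
by rewrite /= -(X_cylinder tsu omts) (size_root_path tsu) uN.
Qed.

Lemma wdim_cat t u v : \sum_(p \in cat t @` paths v u) wpath w p =
  wpath w t * wdim w v u.
Proof.
rewrite fsbig_image; last first.
  by move=> s s' _ _ /eqP; rewrite eqseq_cat// => /andP[_ /eqP].
by rewrite mulr_fsumr; apply: eq_fsbigr => s _; rewrite wpath_cat.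
Qed.

(** By [tail_slice] each path [p] to [u] contributes [c * wpath w p]. The paths through [t] add up
    to [wpath w t * wdim w v u], all paths to [wdim0 w u]. *)
Lemma tail_X P N u A : central w P -> (1 <= N)%N -> V_ N u ->
  measurable A -> tail_invariant N A ->
  forall t v, is_path (root G) t v -> (size t <= N)%N ->
  P (A `&` [set om | X N om = u] `&` cylinder t) =
    ((wpath w t * (wdim w v u / wdim0 w u))%:E *
     P (A `&` [set om | X N om = u]))%E.
Proof.
move=> cP N1 uN mA tA t v tv tN.
have [c cE] := tail_slice cP N1 uN mA tA.
rewrite -setIA (X_bigcup_cylinder uN tv tN) (tail_slice_sum mA cE); last first.
  by move=> _ [s su <-]; apply/is_path_cat; exists v.
rewrite (X_bigcup uN) (tail_slice_sum mA cE)// wdim_cat -EFinM; congr (_%:E).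
rewrite -/(wdim _ _ _) -/(wdim0 _ _).
rewrite [RHS]mulrCA; congr (_ * _).
by rewrite -!mulrA mulVf ?mulr1// gt_eqF// wdim0_gt0.
Qed.

End measures.

(** * The maximal inequality and its consequence under ergodicity *)

Section maximal.
Variables (R : realType) (G : branching_graph).
Variables (nu1 nu2 : {measure set (Omega G) -> \bar R}).
Variables (Q : nat -> vertex G -> Prop) (n0 : nat).
(** The two measures will be a multiple of [P] and the restriction of [P] to a cylinder, in either
    order. *)
Hypothesis slice_le : forall N u (A : set (Omega G)), (n0 <= N)%N ->
  V_ N u -> Q N u -> measurable A -> tail_invariant N A ->
  (nu1 (A `&` [set om | X N om = u]) <= nu2 (A `&` [set om | X N om = u]))%E.

Definition visits n : set (Omega G) :=
  \bigcup_(N in [set N | (n <= N)%N]) [set om | Q N (X N om)].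

Lemma measurable_visits n : measurable (visits n).
Proof. by apply: bigcup_measurable => N _; exact: measurable_X. Qed.

Lemma tail_le N (A : set (Omega G)) : (n0 <= N)%N ->
  measurable A -> tail_invariant N A -> A `<=` [set om | Q N (X N om)] ->
  (nu1 A <= nu2 A)%E.
Proof.
move=> nN mA tA AQ; have [code cinj] := vertex_code G.
pose F i : set (Omega G) := A `&` [set om | code (X N om) = i].
have AF : A = \bigcup_(i in setT) F i.
  apply/seteqP; split=> [om Aom|om [i _ []]//].
  by exists (code (X N om)).
have mF i : measurable (F i).
  by apply: measurableI => //; exact: (measurable_X N (fun x => code x = i)).
have tF : trivIset setT F.
  by move=> i j _ _ [om [[_ <-] [_ <-]]].
rewrite AF !measure_bigcup//; apply: lee_nneseries => // i _.
have [[u ui]|nu] := pselect (exists u, code u = i); last first.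
  rewrite (_ : F i = set0) ?measure0//; apply/seteqP; split=> // om [_ omi].
  by apply: nu; exists (X N om).
rewrite (_ : F i = A `&` [set om | X N om = u]); last first.
  rewrite -ui; apply/seteqP; split=> om [Aom] /=; first by move/cinj.
  by move=> omu; split=> //=; rewrite omu.
(* A point of the slice certifies that [u] has level [N] and satisfies [Q N], as [slice_le]
   requires. *)
have [[om [Aom /= omu]]|E] := pselect (A `&` [set om | X N om = u] !=set0).
  by apply: slice_le => //; rewrite -omu; [exact: vlevel_X|exact: AQ].
by move/set0P/negP: E; rewrite negbK => /eqP ->; rewrite !measure0.
Qed.

(** The inequality is proved for visits within a window of [d] levels, by induction on [d] for all
    starting levels, and passes to the limit by continuity from below. *)
Lemma visits_le : (nu1 (visits n0) <= nu2 (visits n0))%E.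
Proof.
pose U n d : set (Omega G) :=
  [set om | exists N, (n <= N < n + d)%N /\ Q N (X N om)].
have mU n d : measurable (U n d).
  rewrite (_ : U n d = \bigcup_(N in [set N | (n <= N < n + d)%N])
    [set om | Q N (X N om)]).
    by apply: bigcup_measurable => N _; exact: measurable_X.
  by apply/seteqP; split=> [om [N [h q]]|om [N h q]]; exists N.
have tU n d N : (N <= n)%N -> tail_invariant N (U n d).
  move=> Nn om om' E [M [h q]]; exists M; split=> //.
  have /andP[nM _] := h.
  by rewrite -src_pedge -E ?src_pedge// (leq_trans Nn).
(* The disjointification is by the last visit, so that the event {last visit
   at time n} is a tail event at level n. *)
have U_le d n : (n0 <= n)%N -> (nu1 (U n d) <= nu2 (U n d))%E.
  elim: d n => [|d IH] n n0n.
    rewrite (_ : U n 0%N = set0) ?measure0//; apply/seteqP; split=> // om.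
    by move=> [N []]; rewrite addn0 ltnNge => /andP[->].
  pose L := [set om | Q n (X n om)] `\` U n.+1 d : set (Omega G).
  have mL : measurable L by apply: measurableD => //; exact: measurable_X.
  have -> : U n d.+1 = L `|` U n.+1 d.
    apply/seteqP; split=> om.
      move=> [N [/andP[nN Nd] q]].
      have [h|h] := pselect (U n.+1 d om); [by right|left; split=> //=].
      move: nN; rewrite leq_eqVlt => /orP[/eqP ->//|nN].
      by case: h; exists N; rewrite nN addSnnS.
    move=> [[q _]|[N [/andP[nN Nd] q]]].
      by exists n; split=> //; rewrite leqnn addnS ltnS leq_addr.
    by exists N; rewrite ltnW// -addSnnS Nd.
  have L0 : L `&` U n.+1 d = set0.
    by apply/seteqP; split=> // om [[_ ?]].
  rewrite !measureU//; apply: leeD; last by apply: IH; rewrite (leq_trans n0n).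
  apply: (@tail_le n) => //; last by move=> om [].
  move=> om om' E [q nU]; split; first exact: (tail_invariant_X E).
  exact: (tail_invariantC (tU n.+1 d n (leqnSn n))) E nU.
have VU : visits n0 = \bigcup_d U n0 d.
  apply/seteqP; split=> [om [N n0N q]|om [d _ [N [/andP[n0N _] q]]]];
    last by exists N.
  exists (N - n0).+1 => //; exists N; split=> //.
  by move: n0N => /= n0N; rewrite n0N addnS ltnS subnKC ?leqnn.
have mV : measurable (\bigcup_d U n0 d) by rewrite -VU; exact: measurable_visits.
have ndU : {homo U n0 : n m / (n <= m)%N >-> (n <= m)%O}.
  move=> d d' dd'; apply/subsetPset => om [N [/andP[nN Nd] q]]; exists N.
  by rewrite nN (leq_trans Nd)// leq_add2l.
have c1 := nondecreasing_cvg_mu (mu := nu1) (mU n0) mV ndU.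
have c2 := nondecreasing_cvg_mu (mu := nu2) (mU n0) mV ndU.
rewrite VU -(cvg_lim _ c1)// -(cvg_lim _ c2)//.
apply: lee_lim; [exact: cvgP c1|exact: cvgP c2|].
by apply: nearW => d /=; exact: U_le.
Qed.

Definition visits_io : set (Omega G) := \bigcap_n visits n.

(** If infinitely many visits had probability 1, [nu1] would be carried by [visits n0], and the
    maximal inequality would bound its total mass by that of [nu2]. *)
Lemma visits_io_null (P : probability (Omega G) R) : ergodic P ->
  (forall A : set (Omega G), measurable A -> P A = 0%E -> nu1 A = 0%E) ->
  (nu2 setT < nu1 setT)%E -> P visits_io = 0%E.
Proof.
move=> eP ac lt21.
have mI : measurable visits_io.
  by apply: bigcap_measurable => // n _; exact: measurable_visits.
have [//|P1] : P visits_io = 0%E \/ P visits_io = 1%E.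
  (* Infinitely many visits means visits past every level, so edges before level [N] do not
     matter. *)
  apply: eP => //; apply: tail_perm_invariant => N om om' E h n _.
  have [M nM q] := h (maxn N n) I.
  have /andP[NM nM'] : (N <= M)%N && (n <= M)%N by rewrite -geq_max.
  by exists M => //=; rewrite -src_pedge -E ?src_pedge.
have mV := measurable_visits n0.
have PV : P (visits n0) = 1%E.
  apply/eqP; rewrite eq_le probability_le1//= -P1.
  by apply: le_measure; rewrite ?inE// => om; apply.
have nuV : nu1 (~` visits n0) = 0%E.
  apply: ac; first exact: measurableC.
  by rewrite probability_setC// PV subee.
have := lt21; rewrite ltNge => /negP; case.
rewrite -(setvU (visits n0)) measureU//=; first last.
- by rewrite setICl.
- exact: measurableC.
rewrite nuV add0e setvU (le_trans visits_le)//.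
by apply: le_measure; rewrite ?inE.
Qed.
End maximal.

(** * Almost sure convergence for ergodic central measures *)

Section main.
Variables (R : realType) (G : branching_graph) (w : edge G -> R).
Hypothesis w_gt0 : forall e, 0 < w e.
Implicit Types (P : probability (Omega G) R) (u v : vertex G).

Lemma fluctuation_null P v t b : ergodic P -> central w P ->
  is_path (root G) t v ->
  (fine (P (cylinder t)) / wpath w t < b ->
   P (visits_io (fun _ u => b < wdim w v u / wdim0 w u)) = 0%E) /\
  (b < fine (P (cylinder t)) / wpath w t ->
   P (visits_io (fun _ u => wdim w v u / wdim0 w u < b)) = 0%E).
Proof.
move=> eP cP tv.
have mt : measurable (cylinder t : set (Omega G)) := measurable_cylinder tv.
have t0 : 0 < wpath w t := wpath_gt0 w_gt0 t.
have PC0 : 0 <= fine (P (cylinder t)) by exact: fine_ge0.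
have x0 u : 0 <= wdim w v u / wdim0 w u.
  by rewrite divr_ge0 ?wdim_ge0// ltW// wdim0_gt0.
have acC A : measurable A -> P A = 0%E -> P (A `&` cylinder t) = 0%E.
  by move=> mA PA; apply: measure_negligible; [exact: measurableI|
    exists A; split=> // om []].
(* The starting level makes both level conditions of [tail_X] available. *)
have n1 N : (maxn 1 (size t) <= N)%N -> (1 <= N)%N /\ (size t <= N)%N.
  by rewrite geq_max => /andP.
split=> hb.
  have b0 : 0 <= b * wpath w t.
    by rewrite mulr_ge0 ?(ltW t0)// (le_trans _ (ltW hb))// divr_ge0// ltW.
  apply: (@visits_io_null _ _ (mscale (NngNum b0) P) (mrestr P mt) _
    (maxn 1 (size t))) => //.
  - move=> N u A /n1[N1 tN] uN q mA tA; rewrite /= /mscale /mrestr /=.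
    rewrite (tail_X w_gt0 cP N1 uN mA tA tv tN); apply: lee_wpmul2r => //.
    by rewrite lee_fin mulrC ler_wpM2l ?(ltW t0)// ltW.
  - by move=> A mA PA; apply: etrans (mule0 _); congr (_ * _)%E; exact: PA.
  rewrite /= /mscale /mrestr /= setTI probability_setT mule1.
  by rewrite -(fineK (fin_num_measure P _ mt)) lte_fin -ltr_pdivrMr.
(* A negative [b] cannot scale a measure, but then the nonnegative ratio never falls below [b]. *)
have [b0|b0] := ltP b 0.
  rewrite (_ : visits_io _ = set0) ?measure0//; apply/seteqP; split=> // om h.
  have [N _ /=] := h 0%N I.
  by move/lt_trans/(_ b0); rewrite ltNge x0.
have bt0 : 0 <= b * wpath w t by rewrite mulr_ge0// ltW.
apply: (@visits_io_null _ _ (mrestr P mt) (mscale (NngNum bt0) P) _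
    (maxn 1 (size t))) => //.
  move=> N u A /n1[N1 tN] uN q mA tA; rewrite /= /mscale /mrestr /=.
  rewrite (tail_X w_gt0 cP N1 uN mA tA tv tN); apply: lee_wpmul2r => //.
  by rewrite lee_fin [leRHS]mulrC ler_wpM2l ?(ltW t0)// ltW.
rewrite /= /mscale /mrestr /= setTI probability_setT mule1.
by rewrite -(fineK (fin_num_measure P _ mt)) lte_fin -ltr_pdivlMr.
Qed.

Lemma ae_vertex P (H : vertex G -> Omega G -> Prop) :
  (forall v, {ae P, forall om, H v om}) -> {ae P, forall om, forall v, H v om}.
Proof.
move=> h; have [code cinj] := vertex_code G.
have : {ae P, forall om, forall i, forall v, code v = i -> H v om}.
  apply: ae_foralln => i.
  have [[v <-]|nv] := pselect (exists v, code v = i).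
    by apply: filterS (h v) => om Hom v' /cinj ->.
  by apply: nearW => om v vi; case: nv; exists v.
by apply: filterS => om Hom v; exact: Hom.
Qed.

Lemma ae_nvisits P (Q : nat -> vertex G -> Prop) : P (visits_io Q) = 0%E ->
  {ae P, forall om, ~ visits_io Q om}.
Proof.
move=> P0; exists (visits_io Q); split=> //.
  by apply: bigcap_measurable => // n _; exact: measurable_visits.
by move=> om /notP.
Qed.

Lemma ergodic_approximated P : ergodic P -> central w P -> approximated w P.
Proof.
move=> eP cP.
(* One path per vertex suffices: by centrality [l v] is the required limit for every [v] of positive
   level. *)
have [t_ tP] := choice (@root_path G).
pose l v := fine (P (cylinder (t_ v))) / wpath w (t_ v).
have : {ae P, forall om, forall v (k : nat),
   ~ visits_io (fun _ u => l v + k.+1%:R^-1 < wdim w v u / wdim0 w u) om /\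
   ~ visits_io (fun _ u => wdim w v u / wdim0 w u < l v - k.+1%:R^-1) om}.
  apply: ae_vertex => v; apply: ae_foralln => k.
  apply: filterI; apply: ae_nvisits.
    by apply: (fluctuation_null _ eP cP (tP v)).1; rewrite ltrDl.
  by apply: (fluctuation_null _ eP cP (tP v)).2; rewrite gtrBl.
move=> [Z [mZ PZ nZ]].
(* The exceptional set is null and [P] has mass 1, so some path avoids it. *)
have [om omP] : exists om, ~ Z om.
  apply/existsNP => ZT; have : P setT = 0%E.
    by rewrite -PZ; congr (P _); apply/seteqP; split.
  by rewrite probability_setT => /eqP; rewrite onee_eq0.
have /= {nZ omP}H := contrapT (fun h => omP (nZ om h)).
exists om => K v K1 vK.
rewrite -(cP _ _ _ K1 vK (tP v)) -/(l v).
have ev (Q : nat -> vertex G -> Prop) : ~ visits_io Q om ->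
    \forall N \near \oo, ~ Q N (X N om).
  move=> /existsNP[n /not_implyP[_ nV]]; exists n => // N nN q; apply: nV.
  by exists N.
apply/cvgrPdist_le => e e0.
have [k] := ltr_add_invr e0; rewrite add0r => ke.
have [/ev h1 /ev h2] := H v k.
near=> N.
have /negP : ~ (l v + k.+1%:R^-1 < wdim w v (X N om) / wdim0 w (X N om)).
  by near: N.
have /negP : ~ (wdim w v (X N om) / wdim0 w (X N om) < l v - k.+1%:R^-1).
  by near: N.
rewrite -!leNgt => a1 a2; rewrite distrC ler_distl; apply/andP; split.
  by apply: le_trans a1; rewrite lerD2l lerN2 ltW.
by apply: le_trans a2 _; rewrite lerD2l ltW.
Unshelve. all: end_near.
Qed.

End main.

(** * Extremal central measures are ergodic *)

Lemma conditional_probability d (T : measurableType d) (R : realType)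
    (P : probability T R) (B : set T) : measurable B -> P B != 0%E ->
  exists P1 : probability T R,
    forall A, P1 A = (P (B `&` A) * (fine (P B))^-1%:E)%E.
Proof.
move=> mB PB; exists (mnormalize (mrestr P mB) P) => A.
rewrite /= /mnormalize /= /mrestr setTI (negPf PB) /= [B `&` _]setIC.
by case: eqP => // E; have := probability_le1 P mB; rewrite E.
Qed.

Section extremal.
Variables (R : realType) (G : branching_graph) (w : edge G -> R).
Hypothesis w_gt0 : forall e, 0 < w e.
Implicit Types (P : probability (Omega G) R).

(** For a tail event [B], [tail_slice] makes the mass of [B] in the cylinders of paths to [v]
    proportional to their weights; normalizing keeps this. *)
Lemma central_conditional P (B : set (Omega G)) P1 : measurable B ->
  central w P -> (forall N, tail_invariant N B) ->
  (forall A, P1 A = (P (B `&` A) * (fine (P B))^-1%:E)%E) ->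
  central w P1.
Proof.
move=> mB cP tB P1E N v t N1 vN tv.
have [c cE] := tail_slice w_gt0 cP N1 vN mB (tB N).
have -> : fine (P1 (cylinder t)) = c * wpath w t / fine (P B).
  by rewrite P1E cE.
have -> : fine (P1 [set om | X N om = v]) = c * wdim0 w v / fine (P B).
  by rewrite P1E (X_bigcup vN) (tail_slice_sum mB cE).
by rewrite [LHS]mulrAC [RHS]mulrAC !mulfK// gt_eqF// ?wpath_gt0 ?wdim0_gt0.
Qed.

Lemma extremal_ergodic P : extremal_central w P -> ergodic P.
Proof.
move=> [cP eP] B mB inv.
have tB N : tail_invariant N B.
  apply: perm_invariant_tail => g gN; apply: inv; exists N => //.
  exact: generated_gen.
have [|PB0] := eqVneq (P B) 0%E; first by left.
have [|PB1] := eqVneq (P B) 1%E; first by right.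
have mC : measurable (~` B) by exact: measurableC.
pose b := fine (P B).
have Pb : P B = b%:E by rewrite fineK ?fin_num_measure.
have PCb : P (~` B) = (1 - b)%:E by rewrite probability_setC// Pb EFinB.
have b0 : 0 < b by rewrite -lte_fin -Pb lt0e PB0 measure_ge0.
have b1 : b < 1 by rewrite -lte_fin -Pb lt_neqAle PB1 probability_le1.
have b01 : 0 < b < 1 by rewrite b0 b1.
have PC0 : P (~` B) != 0%E by rewrite PCb eqe subr_eq0 eq_sym lt_eqF.
have [P1 P1E] := conditional_probability mB PB0.
have [P2 P2E] := conditional_probability mC PC0.
have c1 := central_conditional mB cP tB P1E.
have c2 := central_conditional mC cP (fun N => tail_invariantC (tB N)) P2E.
(* Extremality would force [P1 B = P B], whereas [P1 B] is 1 and [b < 1]. The other goal is the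
   decomposition of [P] along [B] and its complement. *)
have [|h _] := eP _ _ b c1 c2 b01 _ B mB; last first.
  move: h; rewrite P1E setIid Pb /= -EFinM divff ?gt_eqF// => /eqP.
  by rewrite eqe => /eqP h; move: b1; rewrite -h ltxx.
move=> A mA; rewrite P1E P2E Pb PCb /= ![(P _ * _)%E]muleC !muleA -!EFinM.
rewrite !divff ?mul1e ?gt_eqF ?subr_gt0//.
rewrite -measureU; first by rewrite -setIUl setUv setTI.
- exact: measurableI.
- exact: measurableI.
- by rewrite setIACA setICr set0I.
Qed.
End extremal.

Theorem theorem2p4 (R : realType) (G : branching_graph) (w : edge G -> R)
    (w_gt0 : forall e, 0 < w e) :
  (forall P : probability (Omega G) R,
     ergodic P -> central w P -> approximated w P) /\
  (forall GG : inductive_system R, associated GG w ->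
     forall P : probability (Omega G) R,
       extremal_central w P -> approximated w P).
Proof.
split=> [P|GG _ P eP]; first exact: ergodic_approximated.
by apply: ergodic_approximated => //; [exact: extremal_ergodic eP|exact: eP.1].
Qed.
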